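(* For every integer $t\ge1$, the functions $G\mapsto\operatorname{las}_t(\overline{G})$ and $G\mapsto\operatorname{las}'_t(\overline{G})$ are sandwich functions.
   Context: Graphs are loopless, undirected, and possibly infinite. Let $\mathbb{G}$ be the category whose objects are graphs with finite chromatic number and whose morphisms are graph homomorphisms. $\overline{G}$ is the complement of $G$ (same vertex set, complementary edge set). The join $G*H$ has vertex set the disjoint union of $V(G)$ and $V(H)$, and its edges are all edges of $G$ and $H$ together with all pairs $xy$ with $x\in V(G)$, $y\in V(H)$. A sandwich function is a function $\Psi$ from objects of $\mathbb{G}$ to nonnegative real numbers such that: (1) $\Psi(\emptyset)=0$ for the empty graph, and $\Psi(G)=1$ if $G$ consists of a single vertex; (2) if there is a morphism $G\to G'$ in $\mathbb{G}$, then $\Psi(G)\le\Psi(G')$; (3) $\Psi(G*G')=\Psi(G)+\Psi(G')$ for all $G,G'$. For a finite graph $H$, let $I_{k}$ be the set of independent sets in $H$ of size at most $k$ (including $\emptyset$) and $I_{=1}$ the set of independent sets of size exactly $1$. Then $\operatorname{las}_t(H)$ is the supremum of $\lambda(I_{=1})=\sum_{S\in I_{=1}}\lambda(\{S\})$ over all signed measures $\lambda$ on the finite set $I_{2t}$ such that $\lambda(\{\emptyset\})=1$ and the matrix indexed by $J,J'\in I_t$ with $(J,J')$ entry equal to $\lambda(\{J\cup J'\})$ if $J\cup J'\in I_{2t}$ and $0$ otherwise is positive semidefinite. $\operatorname{las}'_t(H)$ is defined the same way with the additional requirement that $\lambda$ be nonnegative. For a possibly infinite graph $G$ with finite clique covering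 number (i.e., whose vertex set is a union of finitely many cliques), $\operatorname{las}_t(G)$ (resp. $\operatorname{las}'_t(G)$) is the supremum of $\operatorname{las}_t(H)$ (resp. $\operatorname{las}'_t(H)$) over all induced finite subgraphs $H\subseteq G$. *)

(* Defs.v *)
From HB Require Import structures.
From mathcomp Require Import all_boot all_order all_algebra.
From mathcomp Require Import finmap.
From mathcomp Require Import boolp classical_sets reals constructive_ereal ereal.

Set Implicit Arguments.
Unset Strict Implicit.
Unset Printing Implicit Defensive.

Import Order.TTheory GRing.Theory Num.Theory.
Local Open Scope ring_scope.

(* Vertices form an arbitrary, possibly infinite, choiceType and adjacency is
   boolean. With the classical axioms of boolp this loses no generality: every
   type carries a choiceType structure and every relation is boolean. *)
Record graph := Graph {
  vertex :> choiceType;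
  edge : rel vertex;
  edge_sym : symmetric edge;
  edge_irr : irreflexive edge }.

Definition homomorphic (G H : graph) : Prop :=
  exists f : G -> H, forall x y, edge x y -> edge (f x) (f y).

Definition colorable (G : graph) (n : nat) : Prop :=
  exists c : G -> 'I_n, forall x y, edge x y -> c x <> c y.

Definition finite_chromatic (G : graph) : Prop := exists n, colorable G n.

Section Complement.
Variable G : graph.

Definition compl_edge : rel G := fun x y => (x != y) && ~~ edge x y.

Lemma compl_edge_sym : symmetric compl_edge.
Proof. by move=> x y; rewrite /compl_edge eq_sym edge_sym. Qed.

Lemma compl_edge_irr : irreflexive compl_edge.
Proof. by move=> x; rewrite /compl_edge eqxx. Qed.

Definition compl_graph : graph := Graph compl_edge_sym compl_edge_irr.

End Complement.

Section Join.
Variables G H : graph.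

Definition join_edge : rel (G + H)%type := fun u v =>
  match u, v with
  | inl x, inl y => edge x y
  | inr x, inr y => edge x y
  | _, _ => true
  end.

Lemma join_edge_sym : symmetric join_edge.
Proof. by case=> x [] y //=; rewrite edge_sym. Qed.

Lemma join_edge_irr : irreflexive join_edge.
Proof. by case=> x /=; rewrite edge_irr. Qed.

Definition join_graph : graph := Graph join_edge_sym join_edge_irr.

Lemma finite_chromatic_join :
  finite_chromatic G -> finite_chromatic H -> finite_chromatic join_graph.
Proof.
move=> [n [c cP]] [m [d dP]]; exists (n + m)%N.
exists (fun u => match u with
                 | inl x => lshift m (c x)
                 | inr y => rshift n (d y)
                 end).
case=> x [] y /= exy.
- by move/lshift_inj; exact: cP.
- by apply/eqP; rewrite eq_lrshift.
- by apply/eqP; rewrite eq_rlshift.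
- by move/rshift_inj; exact: dP.
Qed.

End Join.

(* The objects of the category of graphs with finite chromatic number; there
   is a morphism from G to H exactly when homomorphic G H. *)
Record fcgraph := FCGraph {
  fcgraph_graph :> graph;
  fcgraphP : finite_chromatic fcgraph_graph }.

Definition fcjoin (G H : fcgraph) : fcgraph :=
  FCGraph (finite_chromatic_join (fcgraphP G) (fcgraphP H)).

Section Lasserre.
Variable R : realType.

Section FiniteGraph.
Variables (T : finType) (e : rel T).

Definition independent (S : {set T}) : bool :=
  [forall x in S, forall y in S, ~~ e x y].

Definition indep_le (k : nat) : {set {set T}} :=
  [set S : {set T} | independent S & (#|S| <= k)%N].

Definition indep_eq (k : nat) : {set {set T}} :=
  [set S : {set T} | independent S & #|S| == k].

(* A signed measure on the finite set indep_le (2 * t) is given by its point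
   masses; the values of lam outside indep_le (2 * t) are never used. *)
Definition moment_mx (t : nat) (lam : {set T} -> R) : 'M[R]_#|indep_le t| :=
  \matrix_(i, j) let S := enum_val i :|: enum_val j in
                 if S \in indep_le (2 * t)%N then lam S else 0.

Definition possemidef (n : nat) (M : 'M[R]_n) : Prop :=
  M \is symmetricmx /\ forall x : 'cV[R]_n, 0 <= (x^T *m M *m x) 0 0.

Definition las_feasible (t : nat) (lam : {set T} -> R) : Prop :=
  lam finset.set0 = 1 /\ possemidef (moment_mx t lam).

Definition las'_feasible (t : nat) (lam : {set T} -> R) : Prop :=
  las_feasible t lam /\ (forall S, S \in indep_le (2 * t)%N -> 0 <= lam S).

Definition las_value (lam : {set T} -> R) : R := \sum_(S in indep_eq 1) lam S.

Definition las_fin (t : nat) : \bar R :=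
  ereal_sup [set (las_value lam)%:E | lam in las_feasible t]%classic.

Definition las'_fin (t : nat) : \bar R :=
  ereal_sup [set (las_value lam)%:E | lam in las'_feasible t]%classic.

End FiniteGraph.

Definition induced_edge (G : graph) (A : {fset G}) : rel A :=
  fun x y => edge (val x) (val y).

(* Total on all graphs; intended for graphs with finite clique covering number,
   that is, for complements of graphs with finite chromatic number. *)
Definition las (t : nat) (G : graph) : \bar R :=
  ereal_sup (range (fun A : {fset G} => las_fin (@induced_edge G A) t)).

Definition las' (t : nat) (G : graph) : \bar R :=
  ereal_sup (range (fun A : {fset G} => las'_fin (@induced_edge G A) t)).

(* Psi takes values in \bar R because las and las' are suprema; that these are
   nonnegative real numbers is the first clause. *)
Definition sandwich_function (Psi : fcgraph -> \bar R) : Prop :=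
  [/\ forall G : fcgraph, (0 <= Psi G < +oo)%E,
      forall G : fcgraph, (G -> False) -> Psi G = 0%E,
      forall G : fcgraph, (exists x : G, forall y : G, y = x) -> Psi G = 1%E,
      forall G G' : fcgraph, homomorphic G G' -> (Psi G <= Psi G')%E
    & forall G G' : fcgraph, Psi (fcjoin G G') = (Psi G + Psi G')%E].

End Lasserre.

(* Main.v *)
(* Independent sets of the complement of G are cliques of G, and a partial map
   that sends edges to edges is injective on cliques; so pushing a measure on
   small cliques forward along such a map turns the moment matrix M into
   P M P^T and keeps feasibility.  This gives monotonicity and, applied to the
   two partial projections of a join, the inequality "<=" in additivity.  For
   ">=" one tensors two feasible measures: the new moment matrix is a principal
   submatrix of a Kronecker product, which is positive semidefinite because
   positive semidefinite matrices are Gram matrices.  Finally the masses of the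
   vertices in one colour class of G, a clique of the complement, add up to at
   most 1 by testing the Gram form on e_0 - sum_v e_{v}; hence the value is at
   most the chromatic number. *)
Require Import Defs.
From mathcomp Require Import all_boot all_order all_algebra.
From mathcomp Require Import finmap.
From mathcomp Require Import boolp classical_sets reals constructive_ereal ereal.
From mathcomp Require Import ring lra.

Set Implicit Arguments.
Unset Strict Implicit.
Unset Printing Implicit Defensive.

Import Order.TTheory GRing.Theory Num.Theory.
Local Open Scope ring_scope.

(** * Positive semidefinite matrices as Gram matrices *)

Section Gram.
Variable R : realType.

Lemma possemidef_sym n (M : 'M[R]_n) i j : possemidef M -> M i j = M j i.
Proof.
by move=> [/is_hermitianmxP + _] => {1}->; rewrite expr0 scale1r !mxE.
Qed.

Lemma gram_possemidef m n (B : 'M[R]_(m, n)) : possemidef (B^T *m B).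
Proof.
split.
  by apply/is_hermitianmxP; rewrite expr0 scale1r map_mx_id // trmx_mul trmxK.
move=> x; rewrite mulmxA -mulmxA -trmx_mul mxE sumr_ge0 // => k _.
by rewrite [_^T _ _]mxE -expr2 sqr_ge0.
Qed.

Lemma quad_addZ n (M : 'M[R]_n) (x : 'cV[R]_n) (i : 'I_n) (c : R) :
  M^T = M ->
  ((x + c *: delta_mx i 0)^T *m M *m (x + c *: delta_mx i 0)) 0 0 =
  (x^T *m M *m x) 0 0 + 2 * c * (row i M *m x) 0 0 + c ^+ 2 * M i i.
Proof.
move=> Msym.
have E1 : (x^T *m M *m @delta_mx R n 1 i 0) 0 0 = (row i M *m x) 0 0.
  rewrite -colE !mxE; apply: eq_bigr => k _.
  by rewrite !mxE -{1}Msym mxE mulrC.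
have E2 : ((@delta_mx R n 1 i 0)^T *m M *m x) 0 0 = (row i M *m x) 0 0.
  by rewrite trmx_delta -rowE.
have E3 : ((@delta_mx R n 1 i 0)^T *m M *m @delta_mx R n 1 i 0) 0 0 = M i i.
  by rewrite trmx_delta -rowE -colE !mxE.
have -> : (x + c *: delta_mx i 0)^T = x^T + c *: (@delta_mx R n 1 i 0)^T.
    by rewrite linearD linearZ.
  rewrite !mulmxDl !mulmxDr -!scalemxAl -!scalemxAr !mxE.
move: E1 E2 E3; rewrite !mxE => -> -> ->.
ring.
Qed.

Lemma possemidef_diag_ge0 n (M : 'M[R]_n) i : possemidef M -> 0 <= M i i.
Proof.
by case=> _ /(_ (delta_mx i 0)); rewrite trmx_delta -rowE -colE !mxE.
Qed.

(** Along e_j + c e_i the form is [M j j + 2 * c * M i j], affine in [c], so a nonzero slope would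
    make it negative somewhere. *)
Lemma possemidef_diag_eq0 n (M : 'M[R]_n) i j :
  possemidef M -> M i i = 0 -> M i j = 0.
Proof.
move=> pM Mii; have Msym : M^T = M.
  by apply/matrixP=> a b; rewrite mxE (possemidef_sym _ _ pM).
apply/eqP; apply: contraT => Mij.
(* The coefficient is chosen so that the form takes the value -1. *)
have := pM.2 (delta_mx j 0 + (- (M j j + 1) / (2 * M i j)) *: delta_mx i 0).
rewrite quad_addZ // trmx_delta -rowE -!colE !mxE Mii mulr0 addr0.
set u := M i j in Mij *; set d := M j j.
have -> : d + 2 * (- (d + 1) / (2 * u)) * u = -1 by field.
by rewrite ler0N1.
Qed.

(* Each step subtracts the rank-one matrix that clears a nonzero diagonal entry
   (a Schur complement). *)
Lemma possemidef_gram n (M : 'M[R]_n) :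
  possemidef M -> exists m (B : 'M[R]_(m, n)), M = B^T *m B.
Proof.
(* Induction on a strict bound for the number of nonzero diagonal entries. *)
move: {2}_.+1 (ltnSn #|[set i | M i i != 0]|) => k.
elim: k M => // k IH M; rewrite ltnS => Mk pM.
have Msym : M^T = M.
  by apply/matrixP=> a b; rewrite mxE (possemidef_sym _ _ pM).
have [i /negPf Mii|M0] := pickP [pred i | M i i != 0]; last first.
  (* With zero diagonal [M] vanishes, so a factor with no rows suffices. *)
  exists 0%N, 0; rewrite mulmx0; apply/matrixP=> a b; rewrite mxE.
  by apply: possemidef_diag_eq0 => //; apply/eqP; have /negbFE := M0 a.
have Mi_gt0 : 0 < M i i by rewrite lt_def Mii possemidef_diag_ge0.
have Mi_neq0 : M i i != 0 by rewrite Mii.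
pose N := M - (M i i)^-1 *: ((row i M)^T *m row i M).
have NE a b : N a b = M a b - (M i i)^-1 * (M i a * M i b).
  by rewrite !mxE big_ord1 !mxE.
have pN : possemidef N.
  split.
    apply/is_hermitianmxP; rewrite expr0 scale1r map_mx_id //.
    apply/matrixP=> a b; rewrite [RHS]mxE !NE (possemidef_sym b a pM).
    by rewrite (mulrC (M i b)).
  move=> x; pose s := (row i M *m x) 0 0.
  (* This shift minimises the form of [M] in direction e_i; the minimum is the form of [N] at
     [x]. *)
  have := pM.2 (x + (- s / M i i) *: delta_mx i 0).
  have ss : ((row i M *m x)^T *m (row i M *m x)) 0 0 = s * s.
    by rewrite mxE big_ord1 mxE.
  have -> : x^T *m N *m x =
      x^T *m M *m x - (M i i)^-1 *: ((row i M *m x)^T *m (row i M *m x)).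
    rewrite /N mulmxBr mulmxBl -scalemxAr -scalemxAl trmx_mul.
    by rewrite !mulmxA.
  rewrite quad_addZ // -/s; move: ss.
  set A := _ *m M *m _; set B := _ *m (_ *m x); rewrite !mxE => ->.
  by congr (0 <= _); field.
have Nk : (#|[set a | N a a != 0%R]| < k)%N.
  (* Zero diagonal entries stay zero because their whole row vanishes, and entry [i] becomes
     zero. *)
  apply: leq_trans Mk; apply: proper_card; apply/properP; split.
    apply/fintype.subsetP => a; rewrite !inE NE; apply: contra => /eqP Ma.
    rewrite Ma (possemidef_sym i a pM) (possemidef_diag_eq0 _ pM Ma).
    by rewrite mul0r mulr0 subrr.
  by exists i; rewrite !inE ?Mii // NE negbK mulrA mulVf // mul1r subrr eqxx.
have [m [B NB]] := IH N Nk pN.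
(* The extra row restores the rank-one matrix subtracted in [N]. *)
exists (m + 1)%N, (col_mx B ((Num.sqrt (M i i))^-1 *: row i M)).
have trZ (c : R) : (c *: row i M)^T = c *: (row i M)^T by rewrite linearZ.
rewrite tr_col_mx mul_row_col -NB trZ -scalemxAl -scalemxAr scalerA.
by rewrite -invfM -expr2 sqr_sqrtr ?ltW // /N subrK.
Qed.

End Gram.

(** * Feasible measures on finite graphs *)

Section FiniteLasserre.
Variables (R : realType) (t : nat).

Lemma indep_leP (T : finType) (e : rel T) k (S : {set T}) :
  reflect ((forall x y, x \in S -> y \in S -> ~~ e x y) /\ (#|S| <= k)%N)
          (S \in indep_le e k).
Proof.
rewrite inE; apply: (iffP andP) => -[indS Sk]; split=> //.
  by move=> x y xS yS; move/forall_inP/(_ x xS)/forall_inP/(_ y yS): indS.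
by apply/forall_inP=> x xS; apply/forall_inP=> y; apply: indS.
Qed.

Lemma indep_le0 (T : finType) (e : rel T) k : finset.set0 \in indep_le e k.
Proof. by apply/indep_leP; rewrite cards0; split=> // x y; rewrite inE. Qed.

Lemma indep_le1 (T : finType) (e : rel T) k x :
  irreflexive e -> (0 < k)%N -> [set x] \in indep_le e k.
Proof.
move=> e_irr k_gt0; apply/indep_leP; rewrite cards1; split=> // a b.
by rewrite !inE => /eqP-> /eqP->; rewrite e_irr.
Qed.

Lemma indep_leS (T : finType) (e : rel T) k (S S' : {set T}) :
  S' \subset S -> S \in indep_le e k -> S' \in indep_le e k.
Proof.
move=> /[dup] /fintype.subsetP S'S /subset_leq_card cS'.
move=> /indep_leP[indS Sk]; apply/indep_leP.
by split=> [x y /S'S xS /S'S|]; [exact: indS | exact: leq_trans Sk].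
Qed.

Lemma las_value_irr (T : finType) (e : rel T) (lam : {set T} -> R) :
  irreflexive e -> las_value e lam = \sum_x lam [set x].
Proof.
move=> e_irr; rewrite /las_value.
rewrite -(big_imset (h := fun x : T => [set x]) (A := predT)) /=; last first.
  by move=> ? ? _ _; apply: finset.set1_inj.
apply: eq_bigl => S; rewrite inE.
apply/andP/imsetP => [[_ /cards1P[x ->]]|[x _ ->]]; first by exists x.
rewrite cards1; split=> //.
by have := indep_le1 x e_irr (ltn0Sn 0); rewrite inE => /andP[].
Qed.

(* Gram form of feasibility: the index set of the moment matrix is replaced by
   all sets of vertices, and only the vectors of the small independent ones
   matter. *)
Lemma las_feasible_gram (T : finType) (e : rel T) (lam : {set T} -> R) :
  las_feasible e t lam <->
  lam finset.set0 = 1 /\ exists (I : finType) (v : I -> {set T} -> R),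
    forall J K, J \in indep_le e t -> K \in indep_le e t ->
      (if J :|: K \in indep_le e (2 * t) then lam (J :|: K) else 0) =
      \sum_k v k J * v k K.
Proof.
split=> -[lam0 H]; split=> //.
  have [n [B MB]] := possemidef_gram H.
  pose rk := enum_rank_in (indep_le0 e t).
  exists 'I_n, (fun k J => B k (rk J)) => J K Jt Kt.
  have /matrixP/(_ (rk J) (rk K)) := MB.
  rewrite mxE !enum_rankK_in // => E; apply: etrans E _.
  by rewrite mxE; apply: eq_bigr => k _; rewrite mxE.
have [I [v vE]] := H.
pose B := \matrix_(k < #|I|, i < #|indep_le e t|) v (enum_val k) (enum_val i).
have -> : moment_mx e t lam = B^T *m B.
  apply/matrixP=> i j; rewrite mxE /= vE ?enum_valP // mxE.
  rewrite (reindex (@enum_val I xpredT)) /=; last first.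
    by exists enum_rank => k _; rewrite ?enum_valK ?enum_rankK.
  by apply: eq_bigr => k _; rewrite !mxE.
exact: gram_possemidef.
Qed.

(* [b] tells [las'] from [las]. *)
Definition las_feas (b : bool) (T : finType) (e : rel T) (lam : {set T} -> R) :=
  las_feasible e t lam /\
  (b -> forall S, S \in indep_le e (2 * t) -> 0 <= lam S).

(** * Push-forward along partial maps *)

Section PushForward.
Variables (T T' : finType) (e : rel T) (e' : rel T') (f : T -> option T').
Hypotheses (e_irr : irreflexive e) (e'_irr : irreflexive e').
Hypothesis f_hom : forall x y a b, x != y -> ~~ e x y ->
  f x = Some a -> f y = Some b -> a != b /\ ~~ e' a b.

(** Comparing images inside [option T'] says at once that [f] is defined on all of [S] and maps it
    onto [S']. *)
Let carries (S : {set T}) (S' : {set T'}) := f @: S == Some @: S'.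

Definition push_meas (lam : {set T} -> R) (S' : {set T'}) : R :=
  \sum_(S in indep_le e (2 * t) | carries S S') lam S.

Lemma carriesP (S : {set T}) (S' : {set T'}) : reflect
  ((forall x, x \in S -> exists2 a, a \in S' & f x = Some a) /\
   (forall a, a \in S' -> exists2 x, x \in S & f x = Some a)) (carries S S').
Proof.
apply: (iffP eqP) => [fS|[fS fS']].
  split=> [x xS|a aS'].
    have : f x \in f @: S by apply: imset_f.
    by rewrite fS => /imsetP[a]; exists a.
  have : Some a \in Some @: S' by apply: imset_f.
  by rewrite -fS => /imsetP[x]; exists x.
apply/setP=> o; apply/imsetP/imsetP => -[z zS ->].
  by have [a aS' ->] := fS z zS; exists a.
by have [x xS <-] := fS' z zS; exists x.
Qed.

(** Distinct vertices of an independent set are non-adjacent, so [f_hom] separates their images. *)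
Lemma carries_inj k S S' x y : S \in indep_le e k -> carries S S' ->
  x \in S -> y \in S -> f x = f y -> x = y.
Proof.
move=> /indep_leP[indS _] /carriesP[fS _] xS yS fxy; apply/eqP.
have [a _ fx] := fS x xS.
apply: contraT => xy.
have [] := f_hom xy (indS _ _ xS yS) fx (etrans (esym fxy) fx).
by rewrite eqxx.
Qed.

Lemma carries_card k S S' : S \in indep_le e k -> carries S S' -> #|S| = #|S'|.
Proof.
move=> Sk SS'.
rewrite -(card_in_imset (f := f) (D := S)); last first.
  by move=> x y xS yS; apply: carries_inj Sk SS' xS yS.
by rewrite (eqP SS') card_imset // => ? ? [].
Qed.

Lemma carries_indep k S S' :
  S \in indep_le e k -> carries S S' -> S' \in indep_le e' k.
Proof.
move=> Sk SS'; apply/indep_leP; split; last first.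
  by rewrite -(carries_card Sk SS'); case/indep_leP: Sk.
have [_ fS'] := carriesP _ _ SS'; have [indS _] := indep_leP _ _ _ Sk.
move=> a b /fS'[x xS fx] /fS'[y yS fy].
have [xy|xy] := eqVneq x y; last by have [] := f_hom xy (indS _ _ xS yS) fx fy.
by move: fx; rewrite xy fy => -[->]; rewrite e'_irr.
Qed.

Lemma carriesU S1 S2 S1' S2' :
  carries S1 S1' -> carries S2 S2' -> carries (S1 :|: S2) (S1' :|: S2').
Proof. by move=> /eqP E1 /eqP E2; rewrite /carries !imsetU E1 E2. Qed.

Lemma carries_part (S : {set T}) (S' J' : {set T'}) :
  J' \subset S' -> carries S S' ->
  carries (S :&: f @^-1: (Some @: J')) J'.
Proof.
move=> /fintype.subsetP J'S' /carriesP[fS fS'].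
apply/carriesP; split=> [x|a aJ'].
  by rewrite !inE => /andP[_ /imsetP[a aJ' fx]]; exists a.
have [x xS fx] := fS' a (J'S' a aJ'); exists x => //.
by rewrite !inE xS fx imset_f.
Qed.

(* An independent set carried to J' :|: K' splits uniquely into a part carried
   to J' and a part carried to K', so the pushed moment matrix is P M P^T with P
   the incidence matrix of [carries]. *)
Lemma push_moment (lam : {set T} -> R) J' K' :
  J' \in indep_le e' t -> K' \in indep_le e' t ->
  (if J' :|: K' \in indep_le e' (2 * t) then push_meas lam (J' :|: K') else 0) =
  \sum_(J in indep_le e t | carries J J')
    \sum_(K in indep_le e t | carries K K')
      if J :|: K \in indep_le e (2 * t) then lam (J :|: K) else 0.
Proof.
move=> J't K't.
(* Only sets in [indep_le e' (2 * t)] have small independent sets carried to them; elsewhere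
   [push_meas] is an empty sum. *)
have -> : (if J' :|: K' \in indep_le e' (2 * t)
    then push_meas lam (J' :|: K') else 0) = push_meas lam (J' :|: K').
  case: ifPn => // notin; rewrite /push_meas big_pred0 // => S.
  by apply: contraNF notin => /andP[]; apply: carries_indep.
rewrite pair_big /= -big_mkcondr /=.
pose F (S' : {set T'}) (S : {set T}) := S :&: f @^-1: (Some @: S').
rewrite (reindex_onto (fun S => (F J' S, F K' S)) (fun p => p.1 :|: p.2)) /=.
  have cover S : carries S (J' :|: K') -> F J' S :|: F K' S = S.
    move=> /carriesP[fS _]; rewrite -finset.setIUr; apply/finset.setIidPl.
    apply/fintype.subsetP=> x /fS[a aJK fx]; rewrite !inE fx.
    by move: aJK; rewrite inE => /orP[] aX; rewrite (imset_f _ aX) ?orbT.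
  apply: eq_big => [S|S /andP[St /cover ->]] //.
  apply/andP/andP => [[St SS']|[/andP[/andP[JJ' KK'] Ut] /eqP FS]].
    have part (X : {set T'}) : X \subset J' :|: K' -> X \in indep_le e' t ->
        (F X S \in indep_le e t) && carries (F X S) X.
      move=> XS' /indep_leP[_ Xt]; have cX := carries_part XS' SS'.
      (* Independence is inherited from [S]; the sharper size bound [t] then follows because
         [carries] preserves cardinality. *)
      have Ft : F X S \in indep_le e (2 * t).
        by apply: indep_leS St; apply: finset.subsetIl.
      rewrite cX andbT; apply/indep_leP.
      by rewrite (carries_card Ft cX); case/indep_leP: Ft.
    by rewrite cover // St !part ?finset.subsetUl ?finset.subsetUr.
  move: Ut; rewrite FS => St; split=> //.
  by case/andP: JJ' KK' => _ JJ' /andP[_ KK']; rewrite -FS carriesU.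
case=> J K /= /andP[/andP[/andP[_ JJ'] /andP[_ KK']] Ut].
have JK := carriesU JJ' KK'.
(* By injectivity on [J :|: K], a vertex with image in [X'] is the vertex of [X] with that image. *)
have FE (X : {set T}) (X' : {set T'}) : X \subset J :|: K -> carries X X' ->
    F X' (J :|: K) = X.
  move=> /fintype.subsetP XJK /carriesP[fX fX']; apply/setP=> x.
  rewrite !inE -finset.in_setU; apply/andP/idP => [[xJK /imsetP[a aX' fx]]|xX].
    have [y yX fy] := fX' a aX'.
    by rewrite (carries_inj Ut JK xJK (XJK y yX) (etrans fx (esym fy))).
  by have [a aX' ->] := fX x xX; rewrite XJK // imset_f.
by congr pair; apply: FE; rewrite ?finset.subsetUl ?finset.subsetUr.
Qed.

Lemma push_meas0 (lam : {set T} -> R) :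
  push_meas lam finset.set0 = lam finset.set0.
Proof.
rewrite /push_meas (big_pred1 finset.set0) // => S /=.
apply/andP/eqP => [[_ /eqP]|->].
  by rewrite imset0 => /eqP; rewrite imset_eq0 => /eqP.
by rewrite indep_le0 /carries !imset0.
Qed.

(** Cardinality is preserved, so only singletons are carried to a singleton. *)
Lemma push_meas1 (lam : {set T} -> R) a : (0 < t)%N ->
  push_meas lam [set a] = \sum_(x | f x == Some a) lam [set x].
Proof.
move=> t_gt0; rewrite /push_meas.
rewrite -(big_imset (h := fun x : T => [set x])
                    (A := [pred x | f x == Some a])) /=; last first.
  by move=> ? ? _ _; apply: finset.set1_inj.
apply: eq_bigl => S.
apply/andP/imsetP => [[St Sa]|[x /eqP fx ->]].
  have /eqP/cards1P[x Sx] : #|S| = 1%N by rewrite (carries_card St Sa) cards1.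
  exists x => //; rewrite Sx in Sa; apply/eqP.
  have [/(_ x (finset.set11 x))[b /set1P-> //] _] := carriesP _ _ Sa.
by rewrite indep_le1 ?muln_gt0 // /carries !imset_set1 fx.
Qed.

Lemma push_feas b (lam : {set T} -> R) :
  las_feas b e lam -> las_feas b e' (push_meas lam).
Proof.
move=> [/las_feasible_gram[lam0 [I [v vE]]] lam_ge0]; split; last first.
  move=> /lam_ge0{}lam_ge0 S' _.
  by apply: sumr_ge0 => S /andP[St _]; apply: lam_ge0.
apply/las_feasible_gram; split; first by rewrite push_meas0.
(* The Gram vector of [J'] is the sum of the vectors of the small independent sets carried to it. *)
exists I, (fun k J' => \sum_(J in indep_le e t | carries J J') v k J).
move=> J' K' J't K't; rewrite push_moment //.
under [RHS]eq_bigr do rewrite big_distrl /=.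
rewrite [RHS]exchange_big /=; apply: eq_bigr => J /andP[Jt _].
under [RHS]eq_bigr do rewrite big_distrr /=.
rewrite [RHS]exchange_big /=; apply: eq_bigr => K /andP[Kt _].
exact: vE.
Qed.

Lemma push_value (lam : {set T} -> R) : (0 < t)%N ->
  las_value e' (push_meas lam) = \sum_(x | f x) lam [set x].
Proof.
move=> t_gt0; rewrite las_value_irr //.
under eq_bigr do rewrite push_meas1 //.
rewrite (exchange_big_dep (fun x => f x : bool)) /=; last first.
  by move=> a x _ /eqP->.
apply: eq_bigr => x; case: (f x) => // a _.
by rewrite (big_pred1 a) // => b; rewrite /= eq_sym (inj_eq (@Some_inj _)).
Qed.

End PushForward.

Lemma las_clique_le1 b (T : finType) (e : rel T) (lam : {set T} -> R)
    (C : pred T) : (0 < t)%N -> irreflexive e -> las_feas b e lam ->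
  (forall x y, C x -> C y -> x != y -> e x y) ->
  \sum_(x | C x) lam [set x] <= 1.
Proof.
move=> t_gt0 e_irr [/las_feasible_gram[lam0 [I [v vE]]] _] Cclq.
set s := \sum_(x | C x) _.
pose w k := \sum_(x | C x) v k [set x].
have i1 x : [set x] \in indep_le e t by apply: indep_le1.
have i1' x : [set x] \in indep_le e (2 * t) by rewrite indep_le1 ?muln_gt0.
have e00 : \sum_k v k finset.set0 ^+ 2 = 1.
  under eq_bigr do rewrite expr2.
  by rewrite -vE ?indep_le0 // finset.set0U indep_le0.
have e0w : \sum_k v k finset.set0 * w k = s.
  under eq_bigr do rewrite big_distrr /=.
  rewrite exchange_big /=; apply: eq_bigr => x _.
  by rewrite -vE ?indep_le0 // finset.set0U i1'.
have eww : \sum_k w k ^+ 2 = s.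
  under eq_bigr do rewrite expr2 big_distrl /=.
  rewrite exchange_big /=; apply: eq_bigr => x Cx.
  under eq_bigr do rewrite big_distrr /=.
  rewrite exchange_big /= (bigD1 x) //= -vE // finset.setUid i1'.
  rewrite big1 ?addr0 // => y /andP[Cy yx]; rewrite -vE //.
  (* Distinct clique vertices do not form an independent set, so their moment entry is the default
     0. *)
  case: ifPn => // /indep_leP[/(_ y x)].
  by rewrite !inE !eqxx orbT Cclq // => /(_ isT isT).
have : 0 <= \sum_k (v k finset.set0 - w k) ^+ 2.
  by apply: sumr_ge0 => k _; apply: sqr_ge0.
(* The sum of squares equals [1 - 2 * s + s]. *)
under eq_bigr do rewrite sqrrB.
rewrite big_split /= eww sumrB e00 sumrMnl e0w; lra.
Qed.

(** * Tensor products of measures *)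

Section Tensor.
Variables (A B : finType) (eA : rel A) (eB : rel B).

(** The complement of a join is the disjoint union of the complements. *)
Definition disjoint_edge : rel (A + B) := fun u v =>
  match u, v with
  | inl x, inl y => eA x y
  | inr x, inr y => eB x y
  | _, _ => false
  end.

Definition tensor_meas (lamA : {set A} -> R) (lamB : {set B} -> R)
  (S : {set A + B}) : R := lamA (inl @^-1: S) * lamB (inr @^-1: S).

Lemma card_sum_set (S : {set A + B}) :
  #|S| = (#|(@inl A B) @^-1: S| + #|(@inr A B) @^-1: S|)%N.
Proof.
rewrite -!sum1_card big_sumType /=.
by congr addn; apply: eq_bigl => x; rewrite inE.
Qed.

Lemma indep_le_preim k (S : {set A + B}) : S \in indep_le disjoint_edge k ->
  (inl @^-1: S \in indep_le eA k) && (inr @^-1: S \in indep_le eB k).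
Proof.
case/indep_leP=> indS; rewrite card_sum_set => Sk; apply/andP.
split; apply/indep_leP; split.
- by move=> x y; rewrite !inE; apply: indS.
- exact: leq_trans (leq_addr _ _) Sk.
- by move=> x y; rewrite !inE; apply: indS.
- exact: leq_trans (leq_addl _ _) Sk.
Qed.

(** The two side conditions alone bound [#|S|] only by [2 * k], whence the size hypothesis. *)
Lemma indep_le_disjointE k (S : {set A + B}) : (#|S| <= k)%N ->
  (S \in indep_le disjoint_edge k) =
  (inl @^-1: S \in indep_le eA k) && (inr @^-1: S \in indep_le eB k).
Proof.
move=> Sk; apply/idP/idP; first exact: indep_le_preim.
case/andP=> /indep_leP[indA _] /indep_leP[indB _]; apply/indep_leP; split=> //.
by case=> x [] y //= xS yS; [apply: indA | apply: indB]; rewrite inE.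
Qed.

Lemma tensor_feas b lamA lamB :
  las_feas b eA lamA -> las_feas b eB lamB ->
  las_feas b disjoint_edge (tensor_meas lamA lamB).
Proof.
move=> [/las_feasible_gram[lA0 [I [v vE]]] lA_ge0].
move=> [/las_feasible_gram[lB0 [I' [w wE]]] lB_ge0]; split; last first.
  move=> b1 S /indep_le_preim/andP[SA SB].
  by rewrite mulr_ge0 ?lA_ge0 ?lB_ge0.
apply/las_feasible_gram; split.
  by rewrite /tensor_meas !preimset0 lA0 lB0 mulr1.
exists (I * I')%type, 
  (fun k (J : {set A + B}) => v k.1 (inl @^-1: J) * w k.2 (inr @^-1: J)).
move=> J K Jt Kt.
(* Since [J :|: K] has at most [2 * t] elements, the support condition factors over the two
   sides. *)
rewrite indep_le_disjointE; last first.
  case/indep_leP: Jt Kt => _ Jt /indep_leP[_ Kt].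
  by rewrite (leq_trans (leq_card_setU _ _)) // mul2n -addnn leq_add.
have /andP[JA JB] := indep_le_preim Jt; have /andP[KA KB] := indep_le_preim Kt.
under eq_bigr do rewrite mulrACA.
rewrite -(pair_big xpredT xpredT (fun i j => v i _ * v i _ * (w j _ * w j _))) /=.
under eq_bigr do rewrite -big_distrr /=.
rewrite -big_distrl /= -vE // -wE // -!preimsetU /tensor_meas.
by do 2!case: (_ \in _); rewrite /= ?mulr0 ?mul0r.
Qed.

(** A singleton has empty preimage on the other side, where the mass is 1. *)
Lemma tensor_meas1 lamA lamB : lamA finset.set0 = 1 -> lamB finset.set0 = 1 ->
  \sum_x tensor_meas lamA lamB [set x] =
  \sum_x lamA [set x] + \sum_x lamB [set x].
Proof.
move=> lA0 lB0; rewrite big_sumType /=; congr (_ + _); apply: eq_bigr => x _.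
  rewrite /tensor_meas [X in lamB X](_ : _ = finset.set0).
    by rewrite lB0 mulr1; congr lamA; apply/setP=> y; rewrite !inE.
  by apply/setP=> y; rewrite !inE.
rewrite /tensor_meas [X in lamA X](_ : _ = finset.set0).
  by rewrite lA0 mul1r; congr lamB; apply/setP=> y; rewrite !inE.
by apply/setP=> y; rewrite !inE.
Qed.

End Tensor.

(** * Values attained on finite subgraphs of the complement *)

Hypothesis t_gt0 : (0 < t)%N.

(** Finite subgraph and measure are quantified together, which merges the nested suprema of [las]
    and [las'] into one supremum of reals. *)
Definition attains (b : bool) (G : graph) (r : R) : Prop :=
  exists A : {fset compl_graph G}, exists2 lam,
    las_feas b (@induced_edge _ A) lam & r = las_value (@induced_edge _ A) lam.

Lemma induced_edge_irr (G : graph) (A : {fset G}) :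
  irreflexive (@induced_edge G A).
Proof. by move=> x; apply: edge_irr. Qed.

Lemma attains_sum b G r : attains b G r <->
  exists A : {fset compl_graph G}, exists2 lam,
    las_feas b (@induced_edge _ A) lam & r = \sum_x lam [set x].
Proof.
by split=> -[A [lam lamF ->]]; exists A, lam => //;
  rewrite las_value_irr //; apply: induced_edge_irr.
Qed.

(** The finitely many images span a finite induced subgraph carrying the push-forward. Morphisms,
    projections, tensor products and one-point graphs all use this. *)
Lemma attains_push b (T : finType) (e : rel T) (G : graph) (f : T -> option G)
    (lam : {set T} -> R) : irreflexive e ->
  (forall x y u v, x != y -> ~~ e x y -> f x = Some u -> f y = Some v ->
     edge u v) ->
  las_feas b e lam -> attains b G (\sum_(x | f x) lam [set x]).
Proof.
move=> e_irr f_hom lamF.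
pose A : {fset compl_graph G} := [fset a | a in pmap f (enum T)]%fset.
have fA x a : f x = Some a -> a \in A.
  move=> fx; rewrite in_fset mem_pmap; apply/mapP.
  by exists x; rewrite ?mem_enum.
(* The corestriction of [f] to [A]; [insub] succeeds on all values of [f], so the domain is
   unchanged. *)
pose f' x : option A := obind insub (f x).
have f'E x (a : A) : f' x = Some a -> f x = Some (val a).
  rewrite /f'; case fx: (f x) => [u|] //=.
  by case: insubP => // c _ <- [->].
have f'T x : (f' x : bool) = f x.
  rewrite /f'; case fx: (f x) => [u|] //=.
  by rewrite insubT ?(fA _ _ fx).
have f'_hom x y (u v : A) : x != y -> ~~ e x y ->
    f' x = Some u -> f' y = Some v -> u != v /\ ~~ induced_edge u v.
  move=> xy exy /f'E fx /f'E fy.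
  have uv := f_hom _ _ _ _ xy exy fx fy.
  split; last by rewrite /induced_edge /= /compl_edge uv andbF.
  by apply: contraTneq uv => ->; rewrite edge_irr.
have A_irr := @induced_edge_irr _ A.
exists A, (push_meas e f' lam); first exact: push_feas lamF.
by rewrite push_value //; apply: eq_bigl => x; rewrite f'T.
Qed.

Lemma attains_hom b (G G' : graph) r :
  homomorphic G G' -> attains b G r -> attains b G' r.
Proof.
move=> [h hP] /attains_sum[A [lam lamF ->]].
apply: (attains_push (f := fun x => Some (h (val x))) _ _ lamF).
  exact: (@induced_edge_irr _ A).
move=> x y _ _ xy + [<-] [<-]; rewrite /induced_edge /= /compl_edge.
by rewrite (inj_eq val_inj) xy /= negbK; apply: hP.
Qed.

Let one_feas b : las_feas b (fun _ _ : unit => false) (fun _ => 1).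
Proof.
split; last by move=> *; apply: ler01.
apply/las_feasible_gram; split=> //; exists unit, (fun _ _ => 1).
move=> J K Jt Kt; rewrite big_const card_unit /= mulr1 addr0 ifT //.
apply/indep_leP; split=> //.
by rewrite (leq_trans (max_card _)) // card_unit muln_gt0.
Qed.

(** The nowhere-defined map leaves an empty sum. *)
Lemma attains0 b (G : graph) : attains b G 0.
Proof.
have := @attains_push b _ _ G (fun _ => None) _ _ _ (one_feas b).
by rewrite big_pred0 //; apply.
Qed.

Lemma attains1 b (G : graph) (x : G) : attains b G 1.
Proof.
have := @attains_push b _ _ G (fun _ => Some x) _ _ _ (one_feas b).
by rewrite /= big_const card_unit /= addr0; apply.
Qed.

(** Besides finiteness, the cases [n = 0] and [n = 1] give the upper bounds for the empty and the
    one-vertex graph. *)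
Lemma attains_colorable b (G : graph) n r :
  colorable G n -> attains b G r -> r <= n%:R.
Proof.
move=> [c cP] /attains_sum[A [lam lamF ->]].
rewrite (partition_big (c \o val) predT) //= -[n in n%:R]card_ord.
rewrite -sumr_const; apply: ler_sum => i _.
apply: (las_clique_le1 t_gt0 _ lamF); first exact: (@induced_edge_irr _ A).
move=> x y /eqP cx /eqP cy xy; rewrite /induced_edge /= /compl_edge.
rewrite (inj_eq val_inj) xy /=; apply/negP => /cP; apply.
by rewrite cx cy.
Qed.

Lemma attains_joinD b (G G' : graph) r r' :
  attains b G r -> attains b G' r' -> attains b (join_graph G G') (r + r').
Proof.
move=> /attains_sum[A [lam lamF ->]] /attains_sum[A' [lam' lamF' ->]].
have [[l0 _] _] := lamF; have [[l0' _] _] := lamF'.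
have := tensor_feas lamF lamF'.
rewrite -tensor_meas1 //.
(* Vertices on different sides are non-adjacent in [disjoint_edge], and their images are adjacent in
   the join. *)
pose f (x : A + A') : option (join_graph G G') :=
  Some match x with inl a => inl (val a) | inr a => inr (val a) end.
apply: (attains_push (f := f)).
  by case=> x; [apply: (@induced_edge_irr _ A) | apply: (@induced_edge_irr _ A')].
move=> x y _ _ xy + [<-] [<-]; case: x y xy => [x|x] [y|y] //=.
  by rewrite /induced_edge /= /compl_edge (inj_eq val_inj) => -> /=; rewrite negbK.
by rewrite /induced_edge /= /compl_edge (inj_eq val_inj) => -> /=; rewrite negbK.
Qed.

(* The projections of the join to its sides are partial homomorphisms. *)
Lemma attains_join b (G G' : graph) r : attains b (join_graph G G') r ->
  exists r1 r2, [/\ attains b G r1, attains b G' r2 & r = r1 + r2].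
Proof.
move=> /attains_sum[C [lam lamF ->]].
pose f (x : C) : option G := if val x is inl a then Some a else None.
pose f' (x : C) : option G' := if val x is inr a then Some a else None.
have C_irr := @induced_edge_irr _ C.
have hom x y : x != y -> ~~ @induced_edge _ C x y ->
    @edge (join_graph G G') (val x) (val y).
  by rewrite /induced_edge /= /compl_edge -(inj_eq val_inj) => -> /=; rewrite negbK.
exists (\sum_(x | f x) lam [set x]), (\sum_(x | f' x) lam [set x]); split.
- apply: attains_push lamF => // x y u v xy /(hom _ _ xy).
  by rewrite /f; case: (val x) (val y) => [?|?] [?|?] //= ? [<-] [<-].
- apply: attains_push lamF => // x y u v xy /(hom _ _ xy).
  by rewrite /f'; case: (val x) (val y) => [?|?] [?|?] //= ? [<-] [<-].
(* Each vertex lies on exactly one side, so the two domains partition [C]. *)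
rewrite (bigID (fun x => f x : bool)) /=; congr (_ + _).
by apply: eq_bigl => x; rewrite /f /f'; case: (val x).
Qed.

(** * The sandwich axioms for the supremum of attained values *)

Definition attained_sup (b : bool) (G : graph) : \bar R :=
  ereal_sup [set r%:E | r in attains b G]%classic.

Lemma attained_supP b G (z : \bar R) :
  reflect (forall r, attains b G r -> (r%:E <= z)%E) (attained_sup b G <= z)%E.
Proof.
apply: (iffP ereal_supP) => [H r rG|H _ [r /= rG <-]]; last exact: H.
by apply: H; exists r.
Qed.

Lemma attained_sup_ub b G r : attains b G r -> (r%:E <= attained_sup b G)%E.
Proof. exact/attained_supP. Qed.

Lemma sandwich_attained_sup b :
  sandwich_function (fun G : fcgraph => attained_sup b G).
Proof.
have fin (G : fcgraph) : (0 <= attained_sup b G < +oo)%E.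
  rewrite attained_sup_ub /=; last exact: attains0.
  have [n Gn] := fcgraphP G; apply: (@le_lt_trans _ _ n%:R%:E); last exact: ltry.
  by apply/attained_supP => r /(attains_colorable Gn); rewrite lee_fin.
have finN (G : fcgraph) : attained_sup b G \is a fin_num.
  by rewrite fin_numElt; have /andP[/(lt_le_trans _)->] := fin G; rewrite ?ltNy0.
split=> //.
- move=> G G0; apply/eqP; rewrite eq_le; have /andP[-> _] := fin G.
  rewrite andbT; apply/attained_supP => r.
  apply: (@attains_colorable b G 0).
  by exists (fun x => False_rect _ (G0 x)) => x; case: (G0 x).
- move=> G [x xP]; apply/eqP; rewrite eq_le; apply/andP; split.
    apply/attained_supP => r; apply: (@attains_colorable b G 1).
    by exists (fun=> ord0) => y z; rewrite (xP y) (xP z) edge_irr.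
  by apply: attained_sup_ub; apply: attains1 x.
- move=> G G' GG'; apply/attained_supP => r /(attains_hom GG').
  exact: attained_sup_ub.
move=> G G'; apply/eqP; rewrite eq_le; apply/andP; split.
  apply/attained_supP => _ /attains_join[r [r' [rG rG' ->]]].
  by rewrite EFinD leeD // attained_sup_ub.
(* Finiteness permits subtraction, so the two suprema are bounded one at a time. *)
rewrite -leeBrDr //; apply/attained_supP => r rG.
rewrite leeBrDr // addeC -leeBrDr //; apply/attained_supP => r' rG'.
rewrite leeBrDr // addeC -EFinD.
exact: attained_sup_ub (attains_joinD rG rG').
Qed.

Lemma las_attained (G : graph) : las R t (compl_graph G) = attained_sup false G.
Proof.
apply/eqP; rewrite eq_le; apply/andP; split.
  apply/ereal_supP => _ [A _ <-]; apply/ereal_supP => _ [lam lamF <-].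
  by apply: attained_sup_ub; exists A, lam.
apply/attained_supP => _ [A [lam [lamF _] ->]].
apply: le_ereal_sup_tmp; eexists; first by exists A.
by apply: ereal_sup_ubound; exists lam.
Qed.

Lemma las'_attained (G : graph) : las' R t (compl_graph G) = attained_sup true G.
Proof.
apply/eqP; rewrite eq_le; apply/andP; split.
  apply/ereal_supP => _ [A _ <-]; apply/ereal_supP => _ [lam [lamF lam0] <-].
  by apply: attained_sup_ub; exists A, lam.
apply/attained_supP => _ [A [lam [lamF lam0] ->]].
apply: le_ereal_sup_tmp; eexists; first by exists A.
by apply: ereal_sup_ubound; exists lam => //; split=> //; apply: lam0.
Qed.

End FiniteLasserre.

Theorem theorem6p12 (R : realType) (t : nat) (ht : (1 <= t)%N) :
  sandwich_function (fun G : fcgraph => las R t (compl_graph G)) /\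
  sandwich_function (fun G : fcgraph => las' R t (compl_graph G)).
Proof.
split.
  have -> : (fun G : fcgraph => las R t (compl_graph G)) =
      fun G => attained_sup R t false G.
    by apply/funext => G; apply: las_attained.
  exact: sandwich_attained_sup.
have -> : (fun G : fcgraph => las' R t (compl_graph G)) =
    fun G => attained_sup R t true G.
  by apply/funext => G; apply: las'_attained.
exact: sandwich_attained_sup.
Qed.
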